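(* Any $X$-symmetric graph $\Sigma$ of even valency $\mathrm v\ge2$ contains a self-paired $X$-orbit $\Delta$ on $Arc_3(\Sigma)$.
   Context: Graphs are finite, simple, undirected. $\Sigma$ is $X$-symmetric if a group $X$ acts on $V(\Sigma)$ preserving adjacency and transitively on vertices and on arcs (ordered pairs of adjacent vertices). A $3$-arc is a sequence $(\alpha_0,\alpha_1,\alpha_2,\alpha_3)$ of vertices with consecutive ones adjacent and $\alpha_0\ne\alpha_2$, $\alpha_1\ne\alpha_3$; $Arc_3(\Sigma)$ is the set of $3$-arcs, on which $X$ acts naturally. A set $\Delta$ of $3$-arcs is self-paired if $(\alpha_0,\alpha_1,\alpha_2,\alpha_3)\in\Delta$ implies $(\alpha_3,\alpha_2,\alpha_1,\alpha_0)\in\Delta$. *)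

(* Defs.v *)
From HB Require Import structures.
From mathcomp Require Import all_boot all_fingroup.
Set Implicit Arguments.
Unset Strict Implicit.
Unset Printing Implicit Defensive.

Section Actions.
Variables (X : groupType) (S : finType).
Implicit Types (to : S -> X -> S) (A D : {set S}).

(* Right actions, with the same convention as mathcomp's action.v; the latter
   only covers finite acting groups, whereas X need not be finite here. *)
Definition group_action to :=
  (forall s, to s 1%g = s) /\
  (forall s (g h : X), to s (g * h)%g = to (to s g) h).

Definition transitive_on to A :=
  forall s t, s \in A -> t \in A -> exists g : X, to s g = t.

Definition orbit_on to A D :=
  exists2 s, s \in A & forall t, t \in D <-> exists g : X, to s g = t.

End Actions.

Section Graphs.
Variable V : finType.
Implicit Types (e : rel V) (D : {set V * V * V * V}).

Definition simple_graph e := symmetric e /\ irreflexive e.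

Definition has_valency e (v : nat) := forall x, #|[set y | e x y]| = v.

Definition arcs e : {set V * V} := [set p | e p.1 p.2].

Definition arcs3 e : {set V * V * V * V} :=
  [set a : V * V * V * V | let: (a0, a1, a2, a3) := a in
    [&& e a0 a1, e a1 a2, e a2 a3, a0 != a2 & a1 != a3]].

Definition self_paired D :=
  forall a0 a1 a2 a3, (a0, a1, a2, a3) \in D -> (a3, a2, a1, a0) \in D.

End Graphs.

Section SymmetricGraphs.
Variables (X : groupType) (V : finType).
Implicit Types (to : V -> X -> V) (e : rel V).

Definition act2 to (p : V * V) (g : X) : V * V := (to p.1 g, to p.2 g).

Definition act4 to (a : V * V * V * V) (g : X) : V * V * V * V :=
  let: (a0, a1, a2, a3) := a in (to a0 g, to a1 g, to a2 g, to a3 g).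

Definition symmetric_graph to e :=
  [/\ group_action to,
      forall (g : X) x y, e (to x g) (to y g) = e x y,
      transitive_on to [set: V] &
      transitive_on (act2 to) (arcs e)].

End SymmetricGraphs.

(* Main.v *)
Require Import Defs.
From mathcomp Require Import all_boot all_fingroup all_solvable.
From mathcomp Require Import boolp.

(** Let [g] swap the ends of an arc [(a, b)]. Replacing [g] by an odd power, we
may assume that it acts as a 2-element; then so does [g ^+ 2], which therefore
fixes a point [c] of the odd set of neighbours of [a] other than [b]. The 3-arc
[(c, a, b, to c g)] is reversed by [g], so its orbit is self-paired. *)

Import GroupScope.

(** The orbits of the 2-group [<[p]>] on [S] have 2-power size, so its fixed points in [S] are
    congruent in number to [#|S|] mod 2. *)
Lemma two_elt_fixes_odd (T : finType) (p : {perm T}) (S : {set T}) :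
  2.-elt p -> odd #|S| -> (forall x, x \in S -> p x \in S) ->
  exists2 x, x \in S & p x = x.
Proof.
move=> p2 oddS pS.
have actS : [acts <[p]>, on S | 'P].
  rewrite cycle_subG; apply/astabsP => x /=.
  have sub : p @: S \subset S by apply/subsetP => _ /imsetP[y yS ->]; exact: pS.
  have /eqP imS : p @: S == S.
    by rewrite eqEcard sub (card_imset _ (@perm_inj _ p)) leqnn.
  by rewrite apermE -[in LHS]imS (mem_imset _ _ (@perm_inj _ p)).
have : odd #|'Fix_(S | 'P)(<[p]>)|.
  by move: (pgroup_fix_mod p2 actS) oddS; rewrite !modn2; do 2 case: odd.
move/odd_gt0/card_gt0P=> [x /setIP[xS /afixP fx]].
by exists x => //; exact: fx _ (cycle_id p).
Qed.

Lemma act_expg (X : groupType) (S : finType) (to : S -> X -> S) (g : X) n s :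
  group_action to -> to s (g ^+ n) = iter n (to^~ g) s.
Proof.
move=> [to1 toM]; elim: n => [|n IHn] /=; first by rewrite expg0.
by rewrite expgSr toM IHn.
Qed.

Lemma act_inj {X : groupType} {S : finType} {to : S -> X -> S} (g : X) :
  group_action to -> injective (to^~ g).
Proof.
move=> [to1 toM]; apply: (can_inj (g := to^~ g^-1)) => s.
by rewrite -toM mulgV to1.
Qed.

Lemma iter_odd_swap (T : Type) (f : T -> T) (a b : T) n :
  f a = b -> f b = a -> odd n -> iter n f a = b /\ iter n f b = a.
Proof.
move=> fa fb on.
suff [-> ->] : iter n f a = (if odd n then b else a) /\
    iter n f b = (if odd n then a else b) by rewrite on.
by elim: n {on} => //= n [-> ->]; case: odd.
Qed.

(** As [X] may be infinite, being a 2-element is asked of the permutation [p] induced by [k], not of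
    [k] itself. *)
Lemma swap_two_elt (X : groupType) (V : finType) (to : V -> X -> V)
    (g : X) (a b : V) :
  group_action to -> to a g = b -> to b g = a ->
  exists (k : X) (p : {perm V}),
    [/\ p =1 to^~ k, 2.-elt p, to a k = b & to b k = a].
Proof.
move=> toP ga gb; pose h := perm (act_inj g toP).
(* The odd part of the order of [h]: the odd power [g ^+ m] still swaps [a] and [b], while [h ^+ m]
   has as order the 2-part of [#[h]]. *)
pose m := (#[h]`_2^')%N.
have oddm : odd m by rewrite -[odd m]negbK -dvdn2 -p'natE // part_pnat.
exists (g ^+ m), (h ^+ m); rewrite !act_expg //.
have [-> ->] := iter_odd_swap V (to^~ g) a b m ga gb oddm.
split=> //.
  by move=> x; rewrite permX act_expg //; apply: eq_iter => y; rewrite permE.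
rewrite /p_elt orderXdiv ?dvdn_part // -[X in X %/ _](partnC 2) ?order_gt0 //.
by rewrite mulnK ?part_gt0 // part_pnat.
Qed.

Theorem theorem5p1 (X : groupType) (V : finType) (to : V -> X -> V)
  (e : rel V) (v : nat)
  (hV : 0 < #|V|)
  (he : simple_graph e)
  (hsym : symmetric_graph to e)
  (hval : has_valency e v)
  (hv2 : 2 <= v)
  (hveven : ~~ odd v) :
  exists D : {set V * V * V * V},
    orbit_on (act4 to) (arcs3 e) D /\ self_paired D.
Proof.
have [esym eirr] := he; have [toP toe _ toarc] := hsym; have [to1 toM] := toP.
have /card_gt0P[a _] := hV.
have /card_gt0P[b] : 0 < #|[set y | e a y]| by rewrite hval ltnW.
rewrite inE => ab.
have [g [ga gb]] : exists g, act2 to (a, b) g = (b, a).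
  by apply: toarc; rewrite inE //= esym.
have [k [p [pE p2 ka kb]]] := swap_two_elt X V to g a b toP ga gb.
pose S := [set y | e a y] :\ b.
have oddS : odd #|S|.
  by move: hveven; rewrite -(hval a) (cardsD1 b) inE ab /= negbK.
have [||c] := two_elt_fixes_odd V (p ^+ 2) S _ oddS.
- exact: p_eltX.
- move=> x; rewrite !inE permX /= !pE => /andP[xb ax].
  (* Applying [k] twice fixes both [a] and [b], hence preserves [S]. *)
  rewrite -{1}ka -{1}kb !(inj_eq (act_inj k toP)) xb.
  by rewrite -{1}kb -{1}ka !toe.
rewrite !inE permX /= !pE => /andP[cb ac] kkc.
pose s := (c, a, b, to c k).
have sP : s \in arcs3 e.
  (* The last adjacency and the last inequality are the images under [k] of [e a c] and [c != b]. *)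
  rewrite inE /= esym ac ab cb -{1}ka toe ac /=.
  by rewrite -{1}kb (inj_eq (act_inj k toP)) eq_sym.
(* Membership in the orbit quantifies over the possibly infinite [X], so it is made boolean
   classically. *)
exists [set t | `[< exists h, act4 to s h = t >]]; split.
  by exists s => // t; rewrite inE; split=> /asboolP.
move=> a0 a1 a2 a3; rewrite !inE => /asboolP[h [<- <- <- <-]].
(* Since [k] reverses [s], the element [k * h] takes [s] to the reversal of its image under [h]. *)
by apply/asboolP; exists (k * h); rewrite /= !toM kkc ka kb.
Qed.
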